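(* Let $(X,\mathcal{B},{\bf b})$ be a coarse proximity space and let $A,B\subseteq X$. Then $A\,{\bf b}\,B$ if and only if $tr(A)\cap tr(B)\neq\emptyset$, where $tr(A)=cl_{\mathfrak{X}}(A)\cap\mathcal{U}X$ denotes the trace of $A$ in the boundary $\mathcal{U}X$.
   Context: Coarse proximity spaces. A bornology $\mathcal{B}$ on a set $X$ is a family of subsets containing all singletons and closed under subsets and finite unions; its members are called bounded, other subsets unbounded. A coarse proximity on $(X,\mathcal{B})$ is a relation ${\bf b}$ on the power set of $X$ such that for all $A,B,C\subseteq X$: (1) $A{\bf b}B\Rightarrow B{\bf b}A$; (2) $A{\bf b}B\Rightarrow A,B\notin\mathcal{B}$; (3) $A\cap B\notin\mathcal{B}\Rightarrow A{\bf b}B$; (4) $(A\cup B){\bf b}C\iff A{\bf b}C$ or $B{\bf b}C$; (5) $A\bar{\bf b}B\Rightarrow\exists E\subseteq X$ with $A\bar{\bf b}E$ and $(X\setminus E)\bar{\bf b}B$ (a bar denotes negation). Then $(X,\mathcal{B},{\bf b})$ is a coarse proximity space. Proximities and clusters. A proximity on a set $X$ is a relation $\delta$ on the power set with: (1) $A\delta B\Rightarrow B\delta A$; (2) $A\delta B\Rightarrow A,B\ne\emptyset$; (3) $A\cap B\neq\emptyset\Rightarrow A\delta B$; (4) $A\delta(B\cup C)\iff A\delta B$ or $A\delta C$; (5) $A\bar\delta B\Rightarrow\exists E\subseteq X$ with $A\bar\delta E$ and $(X\setminus E)\bar\delta B$. It is separated if $\{x\}\delta\{y\}\iff x=y$.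 It induces the topology in which $A$ is closed iff ($A\delta\{x\}\Rightarrow x\in A$). A cluster in $(X,\delta)$ is a collection $\sigma$ of subsets of $X$ such that: $A,B\in\sigma\Rightarrow A\delta B$; if $A\delta B$ for all $B\in\sigma$ then $A\in\sigma$; if $A\cup B\in\sigma$ then $A\in\sigma$ or $B\in\sigma$. For $\delta$ separated, the Smirnov compactification $\mathfrak{X}$ is the set of all clusters with the proximity $\mathcal{A}\delta^*\mathcal{C}$ iff $A\delta C$ for all $A,C\subseteq X$ such that $A\in\sigma$ for all $\sigma\in\mathcal{A}$ and $C\in\sigma$ for all $\sigma\in\mathcal{C}$; it is compact Hausdorff, and $X$ is identified with a dense subset of $\mathfrak{X}$ via $x\mapsto\sigma_x$, the unique cluster containing $\{x\}$. For $A\subseteq X$, $cl_{\mathfrak{X}}(A)=\{\sigma\in\mathfrak{X}\mid A\in\sigma\}$. Boundary. The discrete extension of ${\bf b}$ is the separated proximity $A\delta_{dis}B\iff A\cap B\ne\emptyset$ or $A{\bf b}B$. Here $\mathfrak{X}$ is the Smirnov compactification of $(X,\delta_{dis})$, and $\mathcal{U}X\subseteq\mathfrak{X}$ is the set of clusters in $(X,\delta_{dis})$ containing no bounded set. *)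

(* Defs.v *)
From mathcomp Require Import all_boot.
From mathcomp Require Import mathcomp_extra boolp classical_sets functions cardinality.

Set Implicit Arguments.
Unset Strict Implicit.
Unset Printing Implicit Defensive.

Local Open Scope classical_set_scope.

(* With F empty, bornology_bigcup says that set0 is bounded. *)
Record is_bornology (X : Type) (Bd : set (set X)) : Prop := IsBornology {
  bornology_set1 : forall x : X, Bd [set x];
  bornology_sub : forall A B : set X, A `<=` B -> Bd B -> Bd A;
  bornology_bigcup : forall F : set (set X),
    finite_set F -> F `<=` Bd -> Bd (\bigcup_(A in F) A)
}.

Record is_coarse_proximity (X : Type) (Bd : set (set X))
    (b : set X -> set X -> Prop) : Prop := IsCoarseProximity {
  coarse_prox_sym : forall A B, b A B -> b B A;
  coarse_prox_unbounded : forall A B, b A B -> ~ Bd A /\ ~ Bd B;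
  coarse_prox_setI : forall A B, ~ Bd (A `&` B) -> b A B;
  coarse_prox_setU : forall A B C, b (A `|` B) C <-> b A C \/ b B C;
  coarse_prox_strong : forall A B, ~ b A B ->
    exists E : set X, ~ b A E /\ ~ b (~` E) B
}.

Record is_proximity (X : Type) (d : set X -> set X -> Prop) : Prop :=
  IsProximity {
  prox_sym : forall A B, d A B -> d B A;
  prox_neq0 : forall A B, d A B -> A <> set0 /\ B <> set0;
  prox_setI : forall A B, A `&` B <> set0 -> d A B;
  prox_setU : forall A B C, d A (B `|` C) <-> d A B \/ d A C;
  prox_strong : forall A B, ~ d A B ->
    exists E : set X, ~ d A E /\ ~ d (~` E) B
}.

Definition separated_proximity (X : Type) (d : set X -> set X -> Prop) : Prop :=
  is_proximity d /\ (forall x y : X, d [set x] [set y] <-> x = y).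

Definition prox_closed (X : Type) (d : set X -> set X -> Prop) (A : set X) :
    Prop :=
  forall x : X, d A [set x] -> A x.

(* The closure in the topology induced by d: [smallest C A] is the intersection
   of all members of C that contain A. *)
Definition prox_closure (X : Type) (d : set X -> set X -> Prop) (A : set X) :
    set X :=
  smallest (prox_closed d) A.

Record is_cluster (X : Type) (d : set X -> set X -> Prop)
    (s : set (set X)) : Prop := IsCluster {
  cluster_near : forall A B, s A -> s B -> d A B;
  cluster_max : forall A, (forall B, s B -> d A B) -> s A;
  cluster_setU : forall A B, s (A `|` B) -> s A \/ s B
}.

(* The point set of the Smirnov compactification. *)
Definition smirnov (X : Type) (d : set X -> set X -> Prop) : Type :=
  {s : set (set X) | is_cluster d s}.

Definition smirnov_prox (X : Type) (d : set X -> set X -> Prop)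
    (P Q : set (smirnov d)) : Prop :=
  forall A C : set X,
    (forall s, P s -> sval s A) -> (forall s, Q s -> sval s C) -> d A C.

(* The image of A under the embedding of x as the unique cluster containing
   [set x]; existence and uniqueness are proved in smirnov_point_unique. *)
Definition smirnov_image (X : Type) (d : set X -> set X -> Prop) (A : set X) :
    set (smirnov d) :=
  [set s | exists2 x, A x & sval s [set x]].

Arguments smirnov_image {X} d A.

Definition smirnov_closure (X : Type) (d : set X -> set X -> Prop)
    (A : set X) : set (smirnov d) :=
  prox_closure (@smirnov_prox X d) (smirnov_image d A).

Arguments smirnov_closure {X} d A.

Definition discrete_extension (X : Type) (b : set X -> set X -> Prop)
    (A B : set X) : Prop :=
  A `&` B <> set0 \/ b A B.

Definition boundary (X : Type) (Bd : set (set X)) (b : set X -> set X -> Prop) :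
    set (smirnov (discrete_extension b)) :=
  [set s | forall A, sval s A -> ~ Bd A].

Arguments boundary {X} Bd b.

Definition trace (X : Type) (Bd : set (set X)) (b : set X -> set X -> Prop)
    (A : set X) : set (smirnov (discrete_extension b)) :=
  smirnov_closure (discrete_extension b) A `&` boundary Bd b.

Arguments trace {X} Bd b A.

Lemma prox_subr (X : Type) (d : set X -> set X -> Prop) (A B C : set X) :
  is_proximity d -> B `<=` C -> d A B -> d A C.
Proof.
move=> hd sBC dAB; rewrite -((setUidPr B C).2 sBC).
by apply/(prox_setU hd); left.
Qed.

Lemma prox_subl (X : Type) (d : set X -> set X -> Prop) (A B C : set X) :
  is_proximity d -> A `<=` C -> d A B -> d C B.
Proof.
move=> hd sAC /(prox_sym hd) dBA.
by apply: (prox_sym hd); apply: prox_subr dBA.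
Qed.

Lemma prox_set1 (X : Type) (d : set X -> set X -> Prop) (x : X) :
  is_proximity d -> d [set x] [set x].
Proof.
move=> hd; apply: (prox_setI hd); rewrite setIid => e.
by have : [set x] x by []; rewrite e.
Qed.

Lemma point_cluster (X : Type) (d : set X -> set X -> Prop) (x : X) :
  is_proximity d -> is_cluster d [set A | d A [set x]].
Proof.
move=> hd; split=> /=.
- move=> A B Ax Bx; apply: contrapT => /(prox_strong hd)[E [nAE nEB]].
  have [Ex|nEx] := pselect (E x).
    by apply: nAE; apply: prox_subr Ax => // _ ->.
  apply: nEB; apply: (@prox_subl _ _ [set x]) => //; first by move=> _ ->.
  exact: prox_sym.
- by move=> A; apply; apply: prox_set1.
- move=> A B /(prox_sym hd)/(prox_setU hd)[] h; [left|right]; exact: prox_sym.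
Qed.

Lemma smirnov_point_unique (X : Type) (d : set X -> set X -> Prop) (x : X) :
  is_proximity d ->
  exists! s : smirnov d, sval s [set x].
Proof.
move=> hd; exists (exist _ _ (point_cluster x hd)); split.
  exact: prox_set1.
move=> [s hs] /= sx; apply: eq_exist => /=; apply/seteqP; split=> A /= h.
  apply: (cluster_max hs) => B sB.
  apply: (cluster_near (point_cluster x hd)) => //=; exact: (cluster_near hs).
exact: (cluster_near hs).
Qed.

Lemma smirnov_closureE (X : Type) (d : set X -> set X -> Prop) (A : set X) :
  is_proximity d ->
  smirnov_closure d A = [set s | sval s A].
Proof.
move=> hd; apply/seteqP; split=> [s|s sA F [clF sF]].
  apply; split=> [t h|t [x Ax tx]] /=.
    apply: (cluster_max (svalP t)) => B tB; apply: h => //.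
    by move=> u ->.
  apply: (cluster_max (svalP t)) => B tB; apply: (@prox_subl _ _ [set x]) => //.
    by move=> _ ->.
  exact: (cluster_near (svalP t)).
apply: clF => D C FD sC.
have {}sC : sval s C by apply: sC.
apply: contrapT => nDC.
have /(prox_strong hd)[E [nCE nED]] : ~ d C D by move/(prox_sym hd).
have AE : A `<=` E.
  move=> x Ax; apply: contrapT => nEx; apply: nED.
  apply: (@prox_subl _ _ [set x]) => //; first by move=> _ ->.
  apply: (prox_sym hd).
  apply: (FD (exist _ _ (point_cluster x hd))); apply: sF.
  by exists x => //=; apply: prox_set1.
apply: nCE; apply: prox_subr AE _ => //; exact: (cluster_near (svalP s)).
Qed.

Lemma discrete_extension_separated (X : Type) (Bd : set (set X))
    (b : set X -> set X -> Prop) :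
  is_bornology Bd -> is_coarse_proximity Bd b ->
  separated_proximity (discrete_extension b).
Proof.
move=> hB hb.
have bd0 : Bd set0.
  by rewrite -(bigcup_set0 id); apply: (bornology_bigcup hB).
have sub_b A B C : A `<=` C -> b A B -> b C B.
  by move=> /setUidPr <- bAB; apply/(coarse_prox_setU hb); left.
split; last first.
  move=> x y; split=> [[/eqP/set0P[z [/= -> ->]]//|bxy]|->].
    by case: (coarse_prox_unbounded hb bxy) => /(_ (bornology_set1 hB x)).
  by left; rewrite setIid; apply/eqP/set0P; exists y.
split.
- move=> A B [h|/(coarse_prox_sym hb)]; [left|by right].
  by rewrite setIC.
- move=> A B [h|/(coarse_prox_unbounded hb)[hA hB']].
    by split=> e; apply: h; rewrite e (set0I, setI0).
  by split=> e; [apply: hA|apply: hB']; rewrite e.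
- by move=> A B h; left.
- move=> A B C; split.
    case=> [/eqP/set0P[x [Ax [Bx|Cx]]]|/(coarse_prox_sym hb)].
    + by left; left; apply/eqP/set0P; exists x.
    + by right; left; apply/eqP/set0P; exists x.
    + by move=> /(coarse_prox_setU hb)[] /(coarse_prox_sym hb);
        [left; right|right; right].
  case=> -[/eqP/set0P[x [Ax Bx]]|/(coarse_prox_sym hb) h].
  + by left; apply/eqP/set0P; exists x; split=> //; left.
  + by right; apply: (coarse_prox_sym hb); apply/(coarse_prox_setU hb); left.
  + by left; apply/eqP/set0P; exists x; split=> //; right.
  + by right; apply: (coarse_prox_sym hb); apply/(coarse_prox_setU hb); right.
- move=> A B nAB.
  have AB0 : A `&` B = set0 by apply: contrapT => h; apply: nAB; left.
  have /(coarse_prox_strong hb)[E [nAE nEB]] : ~ b A B.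
    by move=> h; apply: nAB; right.
  exists ((E `|` B) `\` A); split.
    case=> [/eqP/set0P[x [Ax [_]]]//|/(coarse_prox_sym hb) h].
    have /(coarse_prox_setU hb)[] : b (E `|` B) A by apply: sub_b h => x [].
      by move/(coarse_prox_sym hb).
    by move/(coarse_prox_sym hb) => bAB; apply: nAB; right.
  rewrite setCD; case=> [/eqP/set0P[x [[nx|Ax] Bx]]|].
  + by apply: nx; right.
  + by have : (A `&` B) x by []; rewrite AB0.
  + move=> /(coarse_prox_setU hb)[h|bAB]; last by apply: nAB; right.
    by apply: nEB; apply: sub_b h => x nx Ex; apply: nx; left.
Qed.

(* Main.v *)
Require Import Defs.
From mathcomp Require Import all_boot.
From mathcomp Require Import mathcomp_extra boolp classical_sets functions cardinality.
From mathcomp Require Import filter.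

Set Implicit Arguments.
Unset Strict Implicit.
Unset Printing Implicit Defensive.

Local Open Scope classical_set_scope.

(** Since [smirnov_closureE] identifies the closure of [A] with the clusters
    having [A] as a member, a point of both traces is a cluster of unbounded
    sets that contains [A] and [B].

    Such a cluster forces [b A B]: in a cluster of unbounded sets nearness can
    be witnessed at infinity ([boundary_cluster_near]), because a bounded
    intersection [A `&` B] can be cut off from [A] without leaving the cluster.

    Conversely let [b A B]. The sets [D] with [~ b (A `\` D) B], which carry all
    of the nearness of [A] to [B], form a proper filter; an ultrafilter [U]
    refining it contains [A] and consists of sets near [B]
    ([near_ultrafilter]). The sets near every member of an ultrafilter of
    unbounded sets form a cluster of unbounded sets
    ([ultrafilter_coarse_cluster]). For the [U] above this cluster contains [A],
    a member of [U], and [B], which is near every member of [U]. *)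

Lemma bounded_set0 (X : Type) (Bd : set (set X)) :
  is_bornology Bd -> Bd set0.
Proof.
by move=> hBd; rewrite -(bigcup_set0 id); apply: (bornology_bigcup hBd).
Qed.

Lemma coarse_prox_subl (X : Type) (Bd : set (set X))
    (b : set X -> set X -> Prop) (A B C : set X) :
  is_coarse_proximity Bd b -> A `<=` C -> b A B -> b C B.
Proof.
by move=> hb /setUidPr <- bAB; apply/(coarse_prox_setU hb); left.
Qed.

Lemma coarse_prox_subr (X : Type) (Bd : set (set X))
    (b : set X -> set X -> Prop) (A B C : set X) :
  is_coarse_proximity Bd b -> B `<=` C -> b A B -> b A C.
Proof.
move=> hb BC /(coarse_prox_sym hb) bBA.
by apply: (coarse_prox_sym hb); exact: coarse_prox_subl hb BC bBA.
Qed.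

(** When [A `&` B] is bounded, the cluster axioms leave [A `\` B] in the
    cluster, and its nearness to the disjoint set [B] can only come from [b]. *)
Lemma boundary_cluster_near (X : Type) (Bd : set (set X))
    (b : set X -> set X -> Prop) (s : smirnov (discrete_extension b))
    (A B : set X) :
  is_coarse_proximity Bd b -> boundary Bd b s ->
  sval s A -> sval s B -> b A B.
Proof.
move=> hb us sA sB.
have [bdAB|] := pselect (Bd (A `&` B)); last exact: (coarse_prox_setI hb).
have sAB : sval s (A `\` B).
  move: sA; rewrite -{1}(setUIDK A B) => /(cluster_setU (svalP s))[]//.
  by move/us.
have [|] := cluster_near (svalP s) sAB sB.
  by rewrite setDE -setIA setICl setI0.
by apply: (coarse_prox_subl hb) => x [].
Qed.

Definition coarse_cluster (X : Type) (b : set X -> set X -> Prop)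
    (U : set (set X)) : set (set X) :=
  [set C | forall D, U D -> b C D].

Lemma coarse_cluster_unbounded (X : Type) (Bd : set (set X))
    (b : set X -> set X -> Prop) (U : set (set X)) (C : set X) :
  is_coarse_proximity Bd b -> UltraFilter U ->
  coarse_cluster b U C -> ~ Bd C.
Proof.
by move=> hb uU /(_ _ filterT) /(coarse_prox_unbounded hb)[].
Qed.

Lemma ultrafilter_sub_coarse_cluster (X : Type) (Bd : set (set X))
    (b : set X -> set X -> Prop) (U : set (set X)) :
  is_coarse_proximity Bd b -> UltraFilter U -> (forall D, U D -> ~ Bd D) ->
  U `<=` coarse_cluster b U.
Proof.
move=> hb uU unbU C UC D UD; apply: (coarse_prox_setI hb); apply: unbU.
exact: filterI.
Qed.

(** Two members that were not near would be separated, in the sense of the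
    strong axiom, by some [E] with [E] far from one and [~` E] far from the
    other, but [U] contains [E] or [~` E]. For maximality it is enough to test
    against members of [U], which belong to the cluster. A union splits because
    [U] is closed under intersection. *)
Lemma ultrafilter_coarse_cluster (X : Type) (Bd : set (set X))
    (b : set X -> set X -> Prop) (U : set (set X)) :
  is_coarse_proximity Bd b -> UltraFilter U -> (forall D, U D -> ~ Bd D) ->
  is_cluster (discrete_extension b) (coarse_cluster b U).
Proof.
move=> hb uU unbU; split.
- move=> A B sA sB; right; apply: contrapT => /(coarse_prox_strong hb)[E [nAE nEB]].
  case: (in_ultra_setVsetC E uU) => UE; first exact/nAE/sA.
  by apply: nEB; apply: (coarse_prox_sym hb); apply: sB.
- move=> A nearA D UD.
  have [bdAD|] := pselect (Bd (A `&` D)); last exact: (coarse_prox_setI hb).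
  (* Testing [A] against [D `\` A], in which the part of [D] that [A] could
     meet is removed, rules out nearness by mere intersection. *)
  have UDA : U (D `\` A).
    case: (in_ultra_setVsetC A uU) => UA; last exact: filterI.
    by case: (unbU (A `&` D)) => //; apply: filterI.
  case: (nearA (D `\` A)).
  + exact: (ultrafilter_sub_coarse_cluster hb uU unbU).
  + by rewrite setDE setIC -setIA setICl setI0.
  + by apply: (coarse_prox_subr hb) => x [].
- move=> A B sAB; apply: contrapT => /not_orP[].
  move=> /existsNP[D /not_implyP[UD nAD]] /existsNP[D' /not_implyP[UD' nBD']].
  have bDD : b (A `|` B) (D `&` D') by exact/sAB/filterI.
  case/(coarse_prox_setU hb): bDD => h.
  + by apply: nAD; apply: (coarse_prox_subr hb _ h) => x [].
  + by apply: nBD'; apply: (coarse_prox_subr hb _ h) => x [].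
Qed.

(** The sets not near [B] form an ideal which, by [b A B], misses [A]; hence
    the sets whose complement in [A] lies in the ideal form a proper filter. *)
Lemma near_ultrafilter (X : Type) (Bd : set (set X))
    (b : set X -> set X -> Prop) (A B : set X) :
  is_bornology Bd -> is_coarse_proximity Bd b -> b A B ->
  exists U : set (set X), [/\ UltraFilter U, U A & forall D, U D -> b D B].
Proof.
move=> hBd hb bAB.
have nb0 : ~ b set0 B.
  by move=> /(coarse_prox_unbounded hb)[+ _]; apply; apply: bounded_set0.
pose F : set (set X) := [set D | ~ b (A `\` D) B].
have FF : ProperFilter F.
  split; first by rewrite /F /= setD0.
  split; rewrite /F /=.
  - by rewrite setDT.
  - by move=> D D' nD nD'; rewrite /F /= setDIr => /(coarse_prox_setU hb)[].
  - move=> D D' DD' nD h; apply: nD.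
    by apply: (coarse_prox_subl hb _ h); apply: setDS.
have [U [uU FU]] := ultraFilterLemma FF.
exists U; split=> //; first by apply: FU; rewrite /F /= setDv.
move=> D UD; apply: contrapT => nDB.
have UCD : U (~` D).
  apply: FU; rewrite /F /= setDE setCK => h; apply: nDB.
  by apply: (coarse_prox_subl hb _ h) => x [].
by apply: (filter_not_empty U); rewrite -(setICr D); apply: filterI.
Qed.

Theorem proposition4p7 (X : Type) (Bd : set (set X))
    (b : set X -> set X -> Prop)
    (hBd : is_bornology Bd) (hb : is_coarse_proximity Bd b)
    (A B : set X) :
  b A B <-> trace Bd b A `&` trace Bd b B !=set0.
Proof.
have [hd _] := discrete_extension_separated hBd hb.
rewrite /trace !smirnov_closureE//; split; last first.
  by case=> s [[sA us] [sB _]]; apply: (boundary_cluster_near hb us).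
move=> /(near_ultrafilter hBd hb)[U [uU UA nearB]].
have unbU D : U D -> ~ Bd D by move=> /nearB /(coarse_prox_unbounded hb)[].
have cl := ultrafilter_coarse_cluster hb uU unbU.
have us : boundary Bd b (exist _ _ cl).
  by move=> C; apply: coarse_cluster_unbounded.
exists (exist _ _ cl); split; split=> //=.
  exact: (ultrafilter_sub_coarse_cluster hb uU unbU).
by move=> D /nearB; apply: (coarse_prox_sym hb).
Qed.
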